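(* For every $n \in \mathbb{N}$, the problem $\{1,2\}$-CSP$(\mathbf{P}_n)$ is solvable in polynomial time.
   Context: For a finite graph $\mathbf{B}$ (domain $B$, binary edge relation $E$) and a nonempty set $X \subseteq \{1,\ldots,|B|\}$, the problem $X$-CSP$(\mathbf{B})$ takes as input a sentence $Q_1 x_1 Q_2 x_2 \ldots Q_m x_m\, \psi(x_1,\ldots,x_m)$, where $\psi$ is a conjunction of atoms of the form $E(x_i,x_k)$ and each $Q_i$ is a counting quantifier $\exists^{\geq j}$ with $j \in X$; it asks whether the sentence is true in $\mathbf{B}$. Here $\exists^{\geq j} x\, \phi$ means that there exist at least $j$ distinct elements $x$ of $B$ satisfying $\phi$ (so $\exists^{\geq 1}$ is $\exists$). $\mathbf{P}_n$ is the path with vertex set $\{1,2,\ldots,n\}$ and edges $\{i,k\}$ for $|i-k|=1$. *)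

(* Defs.v *)
From HB Require Import structures.
From mathcomp Require Import all_boot.

Set Implicit Arguments.
Unset Strict Implicit.
Unset Printing Implicit Defensive.

(** * Deterministic multi-tape Turing machines and polynomial time *)

Variant move := MoveLeft | Stay | MoveRight.

(* A tape cell holds an input symbol, an auxiliary symbol of the machine, or
   the blank [None]. *)
Definition cell (Sigma Gamma : finType) : Type := option (Sigma + Gamma).

(* The transition function takes a tuple (not a Rocq function) of scanned
   cells, so that it is a finite table.  Tape 0 is the input tape, and
   [verdict q] is [Some b] when [q] is a halting state with answer [b]. *)
Record machine (Sigma : finType) := Machine {
  state : finType;
  work_symbol : finType;
  extra_tapes : nat;
  start : state;
  verdict : state -> option bool;
  delta : state -> extra_tapes.+1.-tuple (cell Sigma work_symbol) ->
          state * extra_tapes.+1.-tuple (cell Sigma work_symbol * move)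
}.

(* A two-way infinite tape: [left_part] lists the cells to the left of the
   head, nearest first, and likewise [right_part]; all cells beyond the lists
   are blank. *)
Record tape (C : Type) := Tape {
  left_part : seq (option C);
  scanned : option C;
  right_part : seq (option C)
}.

Definition write_move (C : Type) (t : tape C) (a : option C * move) : tape C :=
  let: (c, d) := a in
  let: Tape l _ r := t in
  match d with
  | MoveLeft => Tape (behead l) (head None l) (c :: r)
  | Stay => Tape l c r
  | MoveRight => Tape (c :: l) (head None r) (behead r)
  end.

Definition blank_tape (C : Type) : tape C := Tape [::] None [::].

Definition tape_of (C : Type) (s : seq C) : tape C :=
  let u := map Some s in Tape [::] (head None u) (behead u).

Record config (Sigma : finType) (M : machine Sigma) := Config {
  current : state M;
  tapes : (extra_tapes M).+1.-tuple (tape (Sigma + work_symbol M))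
}.

Definition init (Sigma : finType) (M : machine Sigma) (w : seq Sigma) :
    config M :=
  Config (start M)
    [tuple if i == ord0 then tape_of (map inl w) else blank_tape _ |
       i < (extra_tapes M).+1].

Definition step (Sigma : finType) (M : machine Sigma) (c : config M) :
    config M :=
  if verdict (current c) is Some _ then c else
  let: (q, acts) :=
    delta (current c) (map_tuple (@scanned _) (tapes c)) in
  Config q [tuple write_move (tnth (tapes c) i) (tnth acts i) |
              i < (extra_tapes M).+1].

(* Halting configurations are fixed by [step], so this says that [M] halts on
   [w] after at most [t] steps, with answer [b]. *)
Definition answers_within (Sigma : finType) (M : machine Sigma)
    (w : seq Sigma) (t : nat) (b : bool) : Prop :=
  verdict (current (iter t (@step Sigma M) (init M w))) = Some b.

(* The decision problem with instances [x : I], presented to the machine as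
   the words [enc x], and with yes-instances those satisfying [P]. *)
Definition polynomial_time (Sigma : finType) (I : Type)
    (enc : I -> seq Sigma) (P : I -> bool) : Prop :=
  exists (M : machine Sigma) (c d : nat),
    forall x : I, answers_within M (enc x) (c * size (enc x) ^ d + c) (P x).

(** * Constraint satisfaction with counting quantifiers *)

(* The sentence Q_0 x_0 ... Q_(m-1) x_(m-1) psi, where m = [nvars], Q_i is the
   quantifier "there exist at least [tnth quants i]", and psi is the
   conjunction of the atoms E(x_i, x_k) for (i, k) in [atoms]. *)
Record sentence (X : pred nat) := Sentence {
  nvars : nat;
  quants : nvars.-tuple nat;
  atoms : seq ('I_nvars * 'I_nvars);
  quants_in : all X quants
}.

Fixpoint eval_prefix (T : finType) (m : nat) :
    m.-tuple nat -> (m.-tuple T -> bool) -> bool :=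
  match m with
  | 0 => fun _ psi => psi [tuple]
  | m'.+1 => fun qs psi =>
      thead qs <=
        #|[set x : T | eval_prefix (behead_tuple qs)
                         (fun t => psi [tuple of x :: t])]|
  end.

Definition holds (T : finType) (E : rel T) (X : pred nat)
    (phi : sentence X) : bool :=
  eval_prefix (quants phi)
    (fun t : (nvars phi).-tuple T =>
       all (fun a => E (tnth t a.1) (tnth t a.2)) (atoms phi)).

Variant symbol := SymQuant | SymEdge | SymComma | SymStroke.

Definition symbol_to_ord (s : symbol) : 'I_4 :=
  match s with
  | SymQuant => inord 0
  | SymEdge => inord 1
  | SymComma => inord 2
  | SymStroke => inord 3
  end.

Definition symbol_of_ord (i : 'I_4) : symbol :=
  nth SymStroke [:: SymQuant; SymEdge; SymComma] i.

Lemma symbol_to_ordK : cancel symbol_to_ord symbol_of_ord.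
Proof. by case; rewrite /symbol_of_ord /= inordK. Qed.

HB.instance Definition _ := Countable.copy symbol (can_type symbol_to_ordK).
HB.instance Definition _ : isFinite symbol := CanIsFinite symbol_to_ordK.

(* Numbers are written in unary.  As every variable is quantified in the
   prefix, variable indices are smaller than the number of quantifiers, so the
   length of the word is polynomially bounded in that of the same sentence
   with indices in binary. *)
Definition encode_quant (j : nat) : seq symbol :=
  SymQuant :: nseq j SymStroke.

Definition encode_atom (m : nat) (a : 'I_m * 'I_m) : seq symbol :=
  SymEdge :: nseq a.1 SymStroke ++ SymComma :: nseq a.2 SymStroke.

Definition encode (X : pred nat) (phi : sentence X) : seq symbol :=
  flatten (map encode_quant (quants phi)) ++
  flatten (map (@encode_atom (nvars phi)) (atoms phi)).

Definition CSP_polynomial_time (X : pred nat) (T : finType) (E : rel T) :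
    Prop :=
  polynomial_time (@encode X) (@holds T E X).

(* The path with n vertices; [i : 'I_n] stands for the vertex i + 1. *)
Definition path_edge (n : nat) : rel 'I_n :=
  fun i k => (i.+1 == k :> nat) || (k.+1 == i :> nat).

(* Main.v *)
Require Import Defs.
From mathcomp Require Import all_boot zify.

(* Variables are eliminated from the innermost quantifier outwards, keeping a
   table of binary relations R a b between the remaining variables.  Inside a
   connected component the parities of the values are tied together, so each
   relation that constrains anything confines its second argument, given the
   first one, to an interval of vertices of one parity; such intervals have the
   Helly property, also for "at least two common elements".  Hence "there are
   at least q values of y" is equivalent to conditions on pairs of the other
   variables, and the new conditions are again of the same kind: they are
   preserved by the midpoint operation [fmid], because midpoints of two strictly
   increasing pairs of one parity are strictly increasing.  The table has
   quadratic size over an alphabet that depends on n only, and a Turing machine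
   whose tapes are used as stacks performs each elimination in one sweep. *)

Set Implicit Arguments.
Unset Strict Implicit.
Unset Printing Implicit Defensive.

(** * Quantifier prefixes over sequences, and sets closed under midpoints *)

Section SequencePrefix.
Variable T : finType.

Fixpoint eval_seq (qs : seq nat) (psi : seq T -> bool) : bool :=
  if qs is q :: qs' then
    q <= #|[set x : T | eval_seq qs' (fun s => psi (x :: s))]|
  else psi [::].

Lemma eq_eval_seq qs (psi1 psi2 : seq T -> bool) :
  (forall s, size s = size qs -> psi1 s = psi2 s) ->
  eval_seq qs psi1 = eval_seq qs psi2.
Proof.
elim: qs psi1 psi2 => [|q qs IH] psi1 psi2 eq12 /=; first exact: eq12.
congr (_ <= _); apply: eq_card => x; rewrite !inE; apply: IH => s sz_s.
by apply: eq12; rewrite /= sz_s.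
Qed.

Lemma eval_prefixE m (qs : m.-tuple nat) (psi : m.-tuple T -> bool)
    (psi' : seq T -> bool) :
  (forall t, psi t = psi' t) -> eval_prefix qs psi = eval_seq qs psi'.
Proof.
elim: m qs psi psi' => [|m IH] qs psi psi' eq_psi.
  by rewrite (tuple0 qs) /= eq_psi.
case/tupleP: qs => q qs /=; rewrite theadE.
congr (_ <= _); apply: eq_card => x; rewrite !inE.
have -> : behead_tuple [tuple of q :: qs] = qs by apply: val_inj.
by apply: IH => t; rewrite eq_psi.
Qed.

Lemma eval_seq_rcons qs q psi :
  eval_seq (rcons qs q) psi =
  eval_seq qs (fun s => q <= #|[set x | psi (rcons s x)]|).
Proof.
elim: qs psi => //= q' qs IH psi; congr (_ <= _).
by apply: eq_card => x; rewrite !inE IH.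
Qed.

(** A false [b] empties every set of values, and no positive threshold is met by the empty set. This
    moves a condition on the eliminated variable alone out of the prefix. *)
Lemma eval_seq_and qs (psi : seq T -> bool) b :
  all (leq 1) qs ->
  eval_seq qs (fun s => psi s && b) = eval_seq qs psi && b.
Proof.
case: b => [|].
  by move=> _; rewrite andbT; apply: eq_eval_seq => s _; rewrite andbT.
rewrite andbF; elim: qs psi => [|q qs IH] psi /=; first by rewrite andbF.
case/andP=> q_gt0 qs_gt0; apply/negbTE; rewrite -ltnNge.
by rewrite (_ : [set x | _] = set0) ?cards0 //; apply/setP=> x;
  rewrite !inE IH.
Qed.

End SequencePrefix.

(** * Midpoints within a parity class and the Helly property *)

Section MidClosed.

(** For [u = 2a + p] and [v = 2b + p] this is [2c + p] with [c] the floor of [(a + b) / 2]: the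
    midpoint, rounded inside the parity class. *)
Definition fmid (u v : nat) : nat := ((u./2 + v./2)./2).*2 + odd u.

Lemma fmid_lt n u v : u < n -> v < n -> odd u = odd v -> fmid u v < n.
Proof. rewrite /fmid; lia. Qed.

Lemma odd_fmid u v : odd (fmid u v) = odd u.
Proof. by rewrite /fmid oddD odd_double oddb. Qed.

Variable n : nat.
Implicit Types (u v w : 'I_n) (S U : {set 'I_n}) (R : {set 'I_n * 'I_n}).

Definition omid u v : 'I_n := insubd u (fmid u v).

Lemma val_omid u v : odd u = odd v -> omid u v = fmid u v :> nat.
Proof. by move=> uv; rewrite val_insubd fmid_lt. Qed.

(** The midpoint acts as a partial polymorphism, defined where the parities agree in each
    coordinate. *)
Definition rel_closed R := forall u1 v1 u2 v2,
  (u1, v1) \in R -> (u2, v2) \in R -> odd u1 = odd u2 -> odd v1 = odd v2 ->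
  (omid u1 u2, omid v1 v2) \in R.

Definition rel_tight R :=
  exists p, forall u v, (u, v) \in R -> odd u (+) odd v = p.

Definition set_closed S := forall u v,
  u \in S -> v \in S -> odd u = odd v -> omid u v \in S.

Definition one_parity S := forall u v, u \in S -> v \in S -> odd u = odd v.

(** Bisection: the midpoint of [u] and [v] replaces the end on its side of [w], and the distance
    [v - u] decreases until [w] is an end. *)
Lemma set_closed_convex S u v w :
  set_closed S -> u \in S -> v \in S -> u <= w <= v ->
  odd w = odd u -> odd w = odd v -> w \in S.
Proof.
move=> clS; have [k] := ubnP (v - u); elim: k u v => // k IH u v le_k uS vS.
move=> /andP[uw wv] pu pv.
have [/val_inj-> //|neq_wu] := eqVneq (w : nat) u.
have [/val_inj-> //|neq_wv] := eqVneq (w : nat) v.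
have puv : odd u = odd v by rewrite -pu.
have mS := clS _ _ uS vS puv; have vm := val_omid puv.
have pm : odd (omid u v) = odd u by rewrite vm odd_fmid.
have [le_wm|lt_mw] := leqP w (omid u v).
  apply: (IH u (omid u v)) => //; rewrite ?uw ?le_wm ?pm //.
  by move: le_wm; rewrite vm /fmid; lia.
apply: (IH (omid u v) v) => //; rewrite ?wv ?(ltnW lt_mw) ?pm //.
by move: lt_mw; rewrite vm /fmid; lia.
Qed.

(* Midpoints of two strictly increasing pairs of one parity are again
   strictly increasing, so two witnesses are carried to two witnesses. *)
Lemma card_omid S1 S2 S q :
  0 < q <= 2 -> one_parity S1 -> one_parity S2 ->
  (forall u v, u \in S1 -> v \in S2 -> odd u = odd v) ->
  (forall u v, u \in S1 -> v \in S2 -> omid u v \in S) ->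
  q <= #|S1| -> q <= #|S2| -> q <= #|S|.
Proof.
move=> q12 p1 p2 p12 mS.
have [->|q_neq1] := eqVneq q 1.
  case/card_gt0P=> u uS1; case/card_gt0P=> v vS2.
  by apply/card_gt0P; exists (omid u v); apply: mS.
have -> : q = 2 by lia.
case/card_gt1P=> u1 [u2 [u1S u2S u12]]; case/card_gt1P=> v1 [v2 [v1S v2S v12]].
wlog lt_u : u1 u2 u1S u2S u12 / u1 < u2.
  have [lt_u H|lt_u H|/val_inj eq_u] := ltngtP u1 u2; first exact: (H u1 u2).
    by apply: (H u2 u1) => //; rewrite eq_sym.
  by rewrite eq_u eqxx in u12.
wlog lt_v : v1 v2 v1S v2S v12 / v1 < v2.
  have [lt_v H|lt_v H|/val_inj eq_v] := ltngtP v1 v2; first exact: (H v1 v2).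
    by apply: (H v2 v1) => //; rewrite eq_sym.
  by rewrite eq_v eqxx in v12.
apply/card_gt1P; exists (omid u1 v1), (omid u2 v2); split; rewrite ?mS //.
have := p1 _ _ u1S u2S; have := p2 _ _ v1S v2S; have := p12 _ _ u1S v1S.
move=> p11 pv pu; apply/eqP => /(congr1 val) /=.
by rewrite !val_omid // -?pu -?pv // /fmid; lia.
Qed.

Lemma total_max (I : eqType) (r : rel I) (s : seq I) :
  total r -> transitive r -> s != [::] ->
  exists2 a, a \in s & {in s, forall c, r a c}.
Proof.
move=> r_total r_trans; elim: s => // x s IH _.
have [->|/IH[a a_s ra]] := eqVneq s [::].
  exists x; first exact: mem_head.
  by move=> c; rewrite inE => /eqP->; have /orP[] := r_total x x.
have [r_ax|r_xa] := orP (r_total a x).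
  exists a; first by rewrite inE a_s orbT.
  by move=> c; rewrite inE => /predU1P[->|/ra].
exists x; first exact: mem_head.
move=> c; rewrite inE => /predU1P[->|/ra]; last exact: r_trans.
by have /orP[] := r_total x x.
Qed.

(** Comparing sets by their [r]-first elements is a total preorder, even with empty sets among them.
    For [<=] the chosen set has the largest minimum, for the reverse order the smallest maximum. *)
Lemma extremal_set (I : eqType) (s : seq I) (B : I -> {set 'I_n})
    (r : rel 'I_n) :
  total r -> transitive r -> s != [::] ->
  exists2 a, a \in s &
    forall c w, c \in s -> w \in B a -> exists2 x, x \in B c & r x w.
Proof.
move=> r_total r_trans s_n0.
pose below a c := [forall w in B a, [exists x in B c, r x w]].
have [||a a_s max_a] := @total_max _ below s _ _ s_n0.
- move=> a c; have [//|/forall_inPn/=[w wa]] := boolP (below a c).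
  rewrite negb_exists_in => /forall_inP w_min.
  apply/forall_inP => x xc; apply/exists_inP; exists w => //.
  by have := r_total w x; rewrite (negbTE (w_min _ xc)) orbF.
- move=> b a c /forall_inP ab /forall_inP bc; apply/forall_inP => w /ab.
  case/exists_inP=> x /bc/exists_inP[z zc rzx] rxw.
  by apply/exists_inP; exists z => //; apply: r_trans rzx rxw.
exists a => // c w /max_a /forall_inP ac /ac /exists_inP[x xc rxw].
by exists x.
Qed.

(** Take [a] with the largest minimum and [b] with the smallest maximum. A point of [U] common to
    [S a] and [S b] lies between two points of every [S c], hence in [S c] by convexity. So this
    single pairwise intersection is already contained in the full one. *)
Lemma helly (I : eqType) (s : seq I) U (S : I -> {set 'I_n}) q :
  0 < q -> set_closed U -> q <= #|U| ->
  {in s, forall i, set_closed (S i)} -> {in s, forall i, one_parity (S i)} ->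
  {in s &, forall i j, q <= #|U :&: S i :&: S j|} ->
  q <= #|[set w in U | all (fun i => w \in S i) s]|.
Proof.
move=> q_gt0 clU cardU clS parS pairs.
have [->|s_n0] := eqVneq s [::].
  by rewrite (_ : [set _ in _ | _] = U) //; apply/setP=> w; rewrite inE andbT.
pose B i := U :&: S i.
have [||a a_s min_a] := @extremal_set _ s B (fun u v => u <= v) _ _ s_n0.
- by move=> u v; exact: leq_total.
- by move=> u v w; exact: leq_trans.
have [||b b_s max_b] := @extremal_set _ s B (fun u v => v <= u) _ _ s_n0.
- by move=> u v; exact: leq_total.
- by move=> u v w /[swap]; exact: leq_trans.
apply: leq_trans (pairs a b a_s b_s) (subset_leq_card _).
apply/subsetP=> w /setIP[/setIP[wU wa] wb]; rewrite inE wU /=.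
apply/allP=> c c_s.
have wBa : w \in B a by rewrite inE wU.
have wBb : w \in B b by rewrite inE wU.
have [x /setIP[_ xc] xw] := min_a c w c_s wBa.
have [z /setIP[_ zc] wz] := max_b c w c_s wBb.
(* Convexity needs [w] to have the parity of [S c]; a common point [o] of [S a] and [S c] transfers
   it. *)
have/card_gt0P[o /setIP[/setIP[_ oa] oc]] :=
  leq_trans q_gt0 (pairs a c a_s c_s).
have pw : odd w = odd o by apply: (parS a).
have px : odd o = odd x by apply: (parS c).
apply: (@set_closed_convex (S c) x z) => //; first exact: clS.
- by rewrite xw.
- by rewrite pw.
- by rewrite pw px; apply: (parS c).
Qed.

End MidClosed.

(** * Elimination of the innermost variable *)

Section Elimination.
Variable n : nat.
Local Notation bin_rel := {set 'I_n * 'I_n}.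
Implicit Types (R : nat -> nat -> bin_rel) (s : seq 'I_n).

Definition diag (d : bin_rel) : {set 'I_n} := [set w | (w, w) \in d].

Definition witnesses (d x z : bin_rel) (p : 'I_n * 'I_n) : {set 'I_n} :=
  [set w | [&& (w, w) \in d, (p.1, w) \in x & (w, p.2) \in z]].

(* [d], [x], [z] and [r] stand for the entries (y, y), (a, y), (y, b) and
   (a, b), where [y] is the eliminated variable.  A full relation says nothing
   about [y]; using it here would produce a unary constraint off the diagonal,
   which is redundant and would destroy the invariant [off_diag]. *)
Definition eliminate_entry (q : nat) (d x z r : bin_rel) : bin_rel :=
  if (x == setT) || (z == setT) then r
  else r :&: [set p | q <= #|witnesses d x z p|].

Definition eliminate q y R a b :=
  eliminate_entry q (R y y) (R a y) (R y b) (R a b).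

(** The quantifiers come innermost first, so the variable to be eliminated has index [size qs']. The
    test on the diagonal is the part of its condition that involves no other variable. *)
Fixpoint solve (qs : seq nat) (R : nat -> nat -> bin_rel) : bool :=
  if qs is q :: qs' then
    (q <= #|diag (R (size qs') (size qs'))|) &&
    solve qs' (eliminate q (size qs') R)
  else true.

Record table_inv (m : nat) R : Prop := TableInv {
  table_sym : forall a b u v, a < m -> b < m ->
    ((u, v) \in R a b) = ((v, u) \in R b a);
  table_closed : forall a b, a < m -> b < m -> rel_closed (R a b);
  off_diag : forall a b, a < m -> b < m -> a != b ->
    R a b = setT \/ rel_tight (R a b)
}.

(** Tightness of [x] and the equal parities of [p1.1] and [p2.1] give all witnesses of both pairs
    one parity. Their midpoints are then witnesses of the midpoint pair, and [card_omid] counts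
    them. *)
Lemma witnesses_closed d x z (p1 p2 : 'I_n * 'I_n) q :
  0 < q <= 2 -> rel_closed d -> rel_closed x -> rel_closed z ->
  rel_tight x ->
  odd p1.1 = odd p2.1 -> odd p1.2 = odd p2.2 ->
  q <= #|witnesses d x z p1| -> q <= #|witnesses d x z p2| ->
  q <= #|witnesses d x z (omid p1.1 p2.1, omid p1.2 p2.2)|.
Proof.
move=> q12 cld clx clz [p tx] e1 e2.
have par1 w : w \in witnesses d x z p1 -> odd w = p (+) odd p1.1.
  by rewrite inE => /and3P[_ /tx <- _]; rewrite addbAC addbb.
have par2 w : w \in witnesses d x z p2 -> odd w = p (+) odd p1.1.
  by rewrite inE => /and3P[_ /tx <- _]; rewrite addbAC e1 addbb.
apply: card_omid => //.
- by move=> u v /par1-> /par1->.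
- by move=> u v /par2-> /par2->.
- by move=> u v /par1-> /par2->.
move=> u v uW vW; have euv : odd u = odd v by rewrite (par1 u) // (par2 v).
move: uW vW; rewrite !inE /= => /and3P[ud ux uz] /and3P[vd vx vz].
by rewrite cld ?clx ?clz.
Qed.

Lemma eliminate_inv q y R :
  0 < q <= 2 -> table_inv y.+1 R -> table_inv y (eliminate q y R).
Proof.
move=> q12 [symR clR offR].
have xT a : a < y -> (R a y == setT) = (R y a == setT).
  move=> lt_a; have lt_a' := ltnW lt_a.
  by apply/eqP/eqP => full; apply/setP=> -[u v]; rewrite symR // full !inE.
have tightR a : a < y -> R a y != setT -> rel_tight (R a y).
  move=> lt_a; have := offR a y (ltnW lt_a) (ltnSn y) (negbT (ltn_eqF lt_a)).
  by case=> // ->; rewrite eqxx.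
split=> a b.
- move=> u v lt_a lt_b; have [lt_a' lt_b'] := (ltnW lt_a, ltnW lt_b).
  rewrite /eliminate /eliminate_entry (xT a) // (xT b) // orbC.
  case: ifP => _; first exact: symR.
  rewrite !in_setI symR //; congr (_ && _); rewrite !inE; congr (_ <= _).
  apply: eq_card => w; rewrite !inE /=.
  by rewrite (symR a y) // (symR y b) // [X in _ && X]andbC.
- move=> lt_a lt_b; have [lt_a' lt_b'] := (ltnW lt_a, ltnW lt_b).
  rewrite /eliminate /eliminate_entry; case: ifP => [_|]; first exact: clR.
  case/norP=> xnT znT u1 v1 u2 v2; rewrite !in_setI => /andP[r1 +] /andP[r2 +].
  move=> w1 w2 eu ev; rewrite clR //= inE; rewrite !inE in w1 w2.
  apply: (@witnesses_closed _ _ _ (u1, v1) (u2, v2)) => //=; try exact: clR.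
  exact: tightR.
- move=> lt_a lt_b ab; have [lt_a' lt_b'] := (ltnW lt_a, ltnW lt_b).
  rewrite /eliminate /eliminate_entry; case: ifP => [_|]; first exact: offR.
  case/norP=> xnT znT; right.
  have [p tx] := tightR a lt_a xnT.
  have [|p' tz] := tightR b lt_b; first by rewrite xT.
  (* Through a common witness [w], the parities of [u + w] and [v + w] add up to that of [u + v]. *)
  exists (p (+) p') => u v; rewrite !inE => /andP[_ W].
  have /card_gt0P[w] : 0 < #|witnesses (R y y) (R a y) (R y b) (u, v)|.
    by apply: leq_trans W; case/andP: q12.
  rewrite inE /= => /and3P[_ /tx <-]; rewrite symR // => /tz <-.
  by rewrite addbACA addbb addbF.
Qed.

Variable x0 : 'I_n.

Definition consistent R y s : bool :=
  all (fun a => all (fun b => (nth x0 s a, nth x0 s b) \in R a b) (iota 0 y))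
      (iota 0 y).

Lemma consistentP R y s :
  reflect (forall a b, a < y -> b < y -> (nth x0 s a, nth x0 s b) \in R a b)
          (consistent R y s).
Proof.
apply: (iffP allP) => [H a b ya yb|H a].
  have in_iota c : c < y -> c \in iota 0 y by rewrite mem_iota.
  by have /allP := H a (in_iota a ya); apply; apply: in_iota.
rewrite mem_iota => /andP[_ ya]; apply/allP=> b.
rewrite mem_iota => /andP[_ yb].
exact: H.
Qed.

Lemma consistent_rcons R y s w : table_inv y.+1 R -> size s = y ->
  consistent R y.+1 (rcons s w) =
  [&& consistent R y s, (w, w) \in R y y &
      all (fun a => (nth x0 s a, w) \in R a y) (iota 0 y)].
Proof.
move=> [symR _ _] sz_s.
have nth_s a : a < y -> nth x0 (rcons s w) a = nth x0 s a.
  by move=> ya; rewrite nth_rcons sz_s ya.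
have nth_y : nth x0 (rcons s w) y = w by rewrite nth_rcons sz_s ltnn eqxx.
apply/consistentP/and3P=> [H|[/consistentP H ww /allP aw] a b].
  split; first by apply/consistentP=> a b ya yb; have := H a b;
    rewrite !nth_s //; apply; apply: ltnW.
    by have := H y y; rewrite nth_y; apply.
  apply/allP=> a; rewrite mem_iota => /andP[_ ya].
  by have := H a y; rewrite nth_s // nth_y; apply=> //; apply: ltnW.
rewrite !ltnS leq_eqVlt => /predU1P[->|ya];
  rewrite leq_eqVlt => /predU1P[->|yb]; rewrite ?nth_y ?nth_s //.
- by rewrite symR ?ltnS ?(ltnW yb) // aw // mem_iota.
- by rewrite aw // mem_iota.
exact: H.
Qed.

(** From right to left this is [helly], with [U] the diagonal of the entry (y, y) and [S a] the
    values that the component [a] of [s] allows: the new entries are its pairwise hypothesis, the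
    diagonal test its hypothesis on [U]. *)
Lemma eliminate_correct q y R s :
  0 < q <= 2 -> table_inv y.+1 R -> size s = y ->
  (q <= #|[set w | consistent R y.+1 (rcons s w)]|) =
  consistent (eliminate q y R) y s && (q <= #|diag (R y y)|).
Proof.
move=> q12 inv sz_s; have [symR clR offR] := inv.
have q_gt0 : 0 < q by case/andP: q12.
rewrite (_ : [set w | _] = [set w | [&& consistent R y s, w \in diag (R y y) &
    all (fun a => (nth x0 s a, w) \in R a y) (iota 0 y)]]); last first.
  by apply/setP=> w; rewrite inE consistent_rcons // !inE.
(* Elimination only shrinks entries, so a tuple violating the old table violates the new one; on the
   left its set is empty while [q] is positive. *)
have [cons|] := boolP (consistent R y s); last first.
  move=> ncons; rewrite (_ : [set w | _] = set0); last first.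
    by apply/setP=> w; rewrite !inE.
  rewrite cards0 leqNgt q_gt0; apply/esym/negbTE; apply: contra ncons.
  case/andP=> /consistentP H _; apply/consistentP=> a b ya yb.
  by move: (H a b ya yb); rewrite /eliminate /eliminate_entry;
    case: ifP => // _ /setIP[].
apply/idP/andP=> [le_q|[/consistentP elim_s diag_q]].
  split; last first.
    apply: leq_trans le_q (subset_leq_card _).
    by apply/subsetP=> w; rewrite inE => /and3P[].
  apply/consistentP=> a b ya yb; move/consistentP: cons => cons.
  rewrite /eliminate /eliminate_entry; case: ifP=> _; rewrite ?inE cons //=.
  apply: leq_trans le_q (subset_leq_card _); apply/subsetP=> w; rewrite !inE.
  case/and3P=> _ /= -> /allP all_w.
  have aw c : c < y -> (nth x0 s c, w) \in R c y.
    by move=> yc; apply: all_w; rewrite mem_iota.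
  by rewrite aw //= symR ?ltnS ?(ltnW yb) // aw.
(* Only entries that are not full are tight and so give sets of one parity; dropping the full ones
   does not change the intersection. *)
pose I := [seq a <- iota 0 y | R a y != setT].
pose S a := [set w | (nth x0 s a, w) \in R a y].
have I_lt a : a \in I -> a < y by rewrite mem_filter mem_iota => /andP[].
have tightR a : a \in I -> rel_tight (R a y).
  move=> aI; have ya := I_lt a aI.
  have := offR a y (ltnW ya) (ltnSn y) (negbT (ltn_eqF ya)).
  by case=> // full; move: aI; rewrite mem_filter full eqxx.
have /= := @helly n _ I (diag (R y y)) S q q_gt0.
rewrite (_ : [set w in _ | _] = [set w | [&& true, w \in diag (R y y) &
    all (fun a => (nth x0 s a, w) \in R a y) (iota 0 y)]]); last first.
  apply/setP=> w; rewrite !inE /=; congr (_ && _).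
  rewrite /I all_filter; apply: eq_all => a /=.
  by rewrite inE; case: eqP => //= ->; rewrite inE.
apply=> //.
- by move=> u v; rewrite !inE => u_d v_d uv; apply: clR.
- move=> a aI u v; rewrite !inE => ua va uv; have ya := I_lt a aI.
  (* The fixed first coordinate is its own midpoint, so closure of [R a y] passes to its section
     [S a]. *)
  have -> : nth x0 s a = omid (nth x0 s a) (nth x0 s a).
    by apply: val_inj; rewrite /= val_omid // /fmid; lia.
  by apply: clR => //; rewrite ltnS ltnW.
- move=> a aI u v; rewrite !inE => ua va; have [p tx] := tightR a aI.
  by apply: (@addbI (odd (nth x0 s a))); rewrite (tx _ _ ua) (tx _ _ va).
move=> a b aI bI; have [ya yb] := (I_lt a aI, I_lt b bI).
have := elim_s a b ya yb; rewrite /eliminate /eliminate_entry.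
have -> : (R a y == setT) = false.
  by move: aI; rewrite mem_filter => /andP[/negbTE].
have -> : (R y b == setT) = false.
  apply: contraTF bI => /eqP full; rewrite mem_filter negb_and negbK.
  apply/orP; left; apply/eqP/setP=> -[u v].
  by rewrite symR ?ltnS ?(ltnW yb) // full !inE.
rewrite /= !inE => /andP[_ le_q]; apply: leq_trans le_q (subset_leq_card _).
apply/subsetP=> w; rewrite !inE /= => /and3P[-> -> /=].
by rewrite symR ?ltnS ?(ltnW yb).
Qed.

(** Induction on the last quantifier: [eliminate_correct] replaces its body by a smaller table and a
    condition free of variables, which [eval_seq_and] moves to the front. *)
Lemma solve_correct qs R :
  all (pred2 1 2) qs -> table_inv (size qs) R ->
  eval_seq qs (consistent R (size qs)) = solve (rev qs) R.
Proof.
elim/last_ind: qs R => // qs q IH R; rewrite all_rcons size_rcons.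
move=> /andP[q12 qs12] inv.
have q12' : 0 < q <= 2 by case/pred2P: q12 => ->.
rewrite eval_seq_rcons rev_rcons /= size_rev -IH //; last first.
  exact: eliminate_inv.
rewrite andbC -eval_seq_and; last first.
  by apply: sub_all qs12 => ? /pred2P[]->.
by apply: eq_eval_seq => s sz_s; apply: eliminate_correct.
Qed.

End Elimination.

(** * The initial table of a conjunction of edge atoms *)

Section AtomTable.
Variable n : nat.

Definition edge_rel : {set 'I_n * 'I_n} := [set p | path_edge p.1 p.2].

Definition restrict_entry (R : nat -> nat -> {set 'I_n * 'I_n}) i k a b :=
  if (a == i) && (b == k) then edge_rel :&: R a b else R a b.

(** Both orientations are restricted, which keeps the table symmetric. *)
Definition add_atom R (e : nat * nat) :=
  restrict_entry (restrict_entry R e.1 e.2) e.2 e.1.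

Definition atom_table (es : seq (nat * nat)) :
    nat -> nat -> {set 'I_n * 'I_n} :=
  foldl add_atom (fun _ _ => setT) es.

Lemma atom_tableE es a b :
  atom_table es a b =
  if ((a, b) \in es) || ((b, a) \in es) then edge_rel else setT.
Proof.
rewrite /atom_table; elim/last_ind: es => // es [i k] IH.
rewrite foldl_rcons /add_atom /restrict_entry /= IH !mem_rcons !inE !xpair_eqE.
rewrite [(b == i) && _]andbC.
case: ((a == i) && _); case: ((a == k) && _); case: ifP; rewrite ?orbT //=;
  by rewrite ?setIid ?setIT ?setTI ?setIid // => ->.
Qed.

Lemma path_edgeC (u v : 'I_n) : path_edge u v = path_edge v u.
Proof. by rewrite /path_edge orbC. Qed.

Lemma edge_rel_tight : rel_tight edge_rel.
Proof. by exists true => u v; rewrite inE /path_edge /=; lia. Qed.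

(** Writing the even end of an edge as [2a] and the odd end as [2b + 1], adjacency says that [a - b]
    is 0 or 1. Floored averages of two such pairs satisfy this again. *)
Lemma edge_rel_closed : rel_closed edge_rel.
Proof.
move=> u1 v1 u2 v2; rewrite !inE /path_edge /= => e1 e2 pu pv.
by rewrite !val_omid // /fmid; lia.
Qed.

Lemma atom_table_inv es m : table_inv m (atom_table es).
Proof.
split=> a b.
- move=> u v _ _; rewrite !atom_tableE orbC; case: ifP; rewrite !inE //.
  by rewrite path_edgeC.
- move=> _ _; rewrite atom_tableE; case: ifP => _; first exact: edge_rel_closed.
  by move=> u1 v1 u2 v2; rewrite !inE.
- by move=> _ _ _; rewrite atom_tableE; case: ifP => _;
  [right; apply: edge_rel_tight | left].
Qed.

End AtomTable.

Definition nat_atoms m (es : seq ('I_m * 'I_m)) : seq (nat * nat) :=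
  [seq (val e.1, val e.2) | e <- es].


Lemma card_set_ord0 q (S : {set 'I_0}) : 0 < q -> (q <= #|S|) = false.
Proof. by case: q => // q _; rewrite eq_card0 // => -[]. Qed.

Lemma holds_solve n (phi : sentence (pred2 1 2)) :
  holds (@path_edge n) phi =
  solve (rev (quants phi)) (@atom_table n (nat_atoms (atoms phi))).
Proof.
case: phi => m qs es q12; rewrite /holds /=.
(* The empty path has no vertex to serve as [x0]. There a nonempty prefix is false on both sides,
   and a sentence without variables has no atoms. *)
case: n => [|n].
  case: m qs es q12 => [|m] qs es q12.
    by case: es => [|[[]]] //; rewrite (tuple0 qs).
  have q_gt0 : all (leq 1) (rev qs).
    by rewrite all_rev; apply: sub_all q12 => ? /pred2P[]->.
  case/tupleP: qs q12 q_gt0 => q qs /= /andP[q12 _] q_gt0.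
  rewrite theadE card_set_ord0; last by case/pred2P: q12 => ->.
  have: size (rev (q :: qs)) != 0 by rewrite size_rev.
  by case: (rev _) q_gt0 => //= q' qs' /andP[q'_gt0 _] _; rewrite card_set_ord0.
rewrite -(@solve_correct _ ord0) //; last exact: atom_table_inv.
rewrite size_tuple; apply: eval_prefixE => t.
have nth_t (i : 'I_m) : nth ord0 t i = tnth t i by rewrite (tnth_nth ord0).
apply/allP/consistentP => [H a b am bm|H [i k] ik_es /=].
  rewrite atom_tableE; case: ifP => [|_]; last by rewrite inE.
  rewrite (nth_t (Ordinal am)) (nth_t (Ordinal bm)) inE /=.
  case/orP => /mapP[[i k] ik_es [ea eb]].
    have -> : Ordinal am = i by apply: val_inj.
    have -> : Ordinal bm = k by apply: val_inj.
    exact: H ik_es.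
  have -> : Ordinal am = k by apply: val_inj.
  have -> : Ordinal bm = i by apply: val_inj.
  by rewrite path_edgeC; apply: H ik_es.
have := H i k (ltn_ord i) (ltn_ord k); rewrite atom_tableE !nth_t.
suff -> : (i : nat, k : nat) \in nat_atoms es by rewrite inE.
by apply/mapP; exists (i, k).
Qed.

(** * Stack programs and their Turing machines *)

Section StackPrograms.
Variables (C : finType) (k : nat).
Local Notation view := (seq (option C)).
Local Notation stacks := (seq (seq C)).
Local Notation tape_tuple := (k.+1.-tuple (tape C)).

(* An action rewrites the scanned cell of one tape and moves its head;
   [None] as a next control point means that the program exits. *)
Record prog := Prog {
  point : finType;
  entry : point;
  act : point -> view ->
        option point * option (nat * (option C * move))
}.

Definition top (j : nat) (v : view) : option C := nth None v j.

(** The value [g v] is computed before the head moves and is carried in the control point, since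
    after the move the head scans garbage. *)
Definition push j (g : view -> C) : prog :=
  @Prog (option C) None (fun q v =>
    if q is Some x then (None, Some (j, (Some x, Stay)))
    else (Some (Some (g v)), Some (j, (top j v, MoveLeft)))).

Definition pop j : prog :=
  @Prog unit tt (fun _ v => (None, Some (j, (top j v, MoveRight)))).

Definition put j (g : view -> C) : prog :=
  @Prog unit tt (fun _ v => (None, Some (j, (Some (g v), Stay)))).

Definition seqp (a b : prog) : prog :=
  @Prog (point a + point b)%type (inl (entry a)) (fun q v =>
    match q with
    | inl q => let: (r, o) := act q v in
               (Some (if r is Some q' then inl q' else inr (entry b)), o)
    | inr q => let: (r, o) := act q v in (omap inr r, o)
    end).

Definition when (p : view -> bool) (a : prog) : prog :=
  @Prog (option (point a)) None (fun q v =>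
    if q is Some q then let: (r, o) := act q v in (omap Some r, o)
    else (if p v then Some (Some (entry a)) else None, None)).

(** The control point [None] is the loop test. An exit [r = None] of the body becomes [Some None],
    which continues at that test. *)
Definition while (p : view -> bool) (a : prog) : prog :=
  @Prog (option (point a)) None (fun q v =>
    if q is Some q then let: (r, o) := act q v in (Some r, o)
    else (if p v then Some (Some (entry a)) else None, None)).

Definition tape_action o (ts : tape_tuple) (i : 'I_k.+1) : tape C :=
  if o is Some (j, a) then
    if i == j :> nat then write_move (tnth ts i) a else tnth ts i
  else tnth ts i.

Definition apply_action o (ts : tape_tuple) : tape_tuple :=
  [tuple tape_action o ts i | i < k.+1].

Definition scan (ts : tape_tuple) : view := map (@scanned _) ts.

Inductive exec (a : prog) :
    point a -> tape_tuple -> nat -> tape_tuple -> Prop :=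
| exec_exit q o ts :
    act q (scan ts) = (None, o) -> exec q ts 1 (apply_action o ts)
| exec_step q q' o ts t ts' :
    act q (scan ts) = (Some q', o) -> exec q' (apply_action o ts) t ts' ->
    exec q ts t.+1 ts'.

Lemma exec_seqr a b q ts t ts' :
  @exec b q ts t ts' -> @exec (seqp a b) (inr q) ts t ts'.
Proof.
elim=> {q ts t ts'} [q o ts E|q q' o ts t ts' E _ IH].
  by apply: (@exec_exit (seqp a b)); rewrite /= E.
by apply: (@exec_step (seqp a b) _ (inr q') o) IH; rewrite /= E.
Qed.

Lemma exec_seql a b q ts t ts' t' ts'' :
  @exec a q ts t ts' -> @exec b (entry b) ts' t' ts'' ->
  @exec (seqp a b) (inl q) ts (t + t') ts''.
Proof.
elim=> {q ts t ts'} [q o ts E|q q' o ts t ts' E _ IH] ex_b.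
  rewrite add1n; apply: (@exec_step (seqp a b) _ (inr (entry b)) o).
    by rewrite /= E.
  exact: exec_seqr.
rewrite addSn; apply: (@exec_step (seqp a b) _ (inl q') o); last exact: IH.
by rewrite /= E.
Qed.

Lemma exec_when p a q ts t ts' :
  @exec a q ts t ts' -> @exec (when p a) (Some q) ts t ts'.
Proof.
elim=> {q ts t ts'} [q o ts E|q q' o ts t ts' E _ IH].
  by apply: (@exec_exit (when p a)); rewrite /= E.
by apply: (@exec_step (when p a) _ (Some q') o) IH; rewrite /= E.
Qed.

Lemma exec_while p a q ts t ts' t' ts'' :
  @exec a q ts t ts' -> @exec (while p a) None ts' t' ts'' ->
  @exec (while p a) (Some q) ts (t + t') ts''.
Proof.
elim=> {q ts t ts'} [q o ts E|q q' o ts t ts' E _ IH] ex_w.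
  by rewrite add1n; apply: (@exec_step (while p a) _ None o) ex_w; rewrite /= E.
rewrite addSn; apply: (@exec_step (while p a) _ (Some q') o); last exact: IH.
by rewrite /= E.
Qed.

(* A tape holds a stack to the right of its head, with the top element in the
   scanned cell; whatever lies to the left is garbage. *)
Definition holds_stack (t : tape C) (s : seq C) : Prop :=
  forall i, nth None (scanned t :: right_part t) i = nth None (map Some s) i.

Lemma holds_stack_scanned t s : holds_stack t s -> scanned t = ohead s.
Proof. by move=> /(_ 0) /= ->; case: s. Qed.

Lemma holds_stack_pop t s c :
  holds_stack t s -> holds_stack (write_move t (c, MoveRight)) (behead s).
Proof.
case: t => l c0 r H i /=.
have -> : nth None (head None r :: behead r) i = nth None r i.
  by case: r {H} => [|? ?] //; case: i => // i; rewrite /= !nth_nil.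
by have /= -> := H i.+1; case: s {H} => //; rewrite /= nth_nil.
Qed.

Lemma holds_stack_put t s x :
  holds_stack t s -> holds_stack (write_move t (Some x, Stay)) (x :: behead s).
Proof.
case: t => l c r H [|i] //=; have /= -> := H i.+1.
by case: s {H} => //; rewrite /= nth_nil.
Qed.

Lemma holds_stack_push t s x :
  holds_stack t s ->
  holds_stack (write_move (write_move t (scanned t, MoveLeft)) (Some x, Stay))
    (x :: s).
Proof. by case: t => l c r H [|i] //; apply: (H i). Qed.

Definition represents (ts : tape_tuple) (sg : stacks) : Prop :=
  size sg = k.+1 /\
  forall i : 'I_k.+1, holds_stack (tnth ts i) (nth [::] sg i).

Definition view_of (sg : stacks) : view := map ohead sg.

Lemma scan_represents ts sg : represents ts sg -> scan ts = view_of sg.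
Proof.
case=> sz_sg H; apply: (@eq_from_nth _ None) => [|i].
  by rewrite !size_map size_tuple sz_sg.
rewrite size_map size_tuple => lt_i.
rewrite (nth_map (blank_tape _)) ?size_tuple // (nth_map [::]) ?sz_sg //.
have /holds_stack_scanned := H (Ordinal lt_i).
by rewrite (tnth_nth (blank_tape _)).
Qed.

Definition runs (a : prog) (sg : stacks) (bound : nat) (sg' : stacks) : Prop :=
  forall ts, represents ts sg ->
  exists t ts', [/\ t <= bound, exec (entry a) ts t ts' & represents ts' sg'].

Lemma represents_act ts sg j a s : j < k.+1 -> represents ts sg ->
  (forall t, holds_stack t (nth [::] sg j) -> holds_stack (write_move t a) s) ->
  represents (apply_action (Some (j, a)) ts) (set_nth [::] sg j s).
Proof.
move=> lt_j [sz_sg H] Ha; split.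
  by rewrite size_set_nth sz_sg; apply/maxn_idPr.
move=> i; rewrite tnth_mktuple nth_set_nth /=.
by case: eqP => [eq_i|_] //; apply: Ha; rewrite -eq_i.
Qed.

Lemma represents_idle ts sg :
  represents ts sg -> represents (apply_action None ts) sg.
Proof. by case=> sz H; split=> // i; rewrite tnth_mktuple; apply: H. Qed.

Lemma top_view j sg : top j (view_of sg) = ohead (nth [::] sg j).
Proof.
rewrite /top /view_of; have [lt_j|le_j] := ltnP j (size sg).
  by rewrite (nth_map [::]).
by rewrite !nth_default ?size_map.
Qed.

Lemma runs_pop j sg : j < k.+1 ->
  runs (pop j) sg 1 (set_nth [::] sg j (behead (nth [::] sg j))).
Proof.
move=> lt_j ts rep; eexists _, _; split; first exact: leqnn.
  exact: exec_exit.
by apply: represents_act => // t; apply: holds_stack_pop.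
Qed.

Lemma runs_put j g sg : j < k.+1 ->
  runs (put j g) sg 1
    (set_nth [::] sg j (g (view_of sg) :: behead (nth [::] sg j))).
Proof.
move=> lt_j ts rep; eexists _, _; split; first exact: leqnn.
  exact: exec_exit.
rewrite (scan_represents rep).
by apply: represents_act => // t; apply: holds_stack_put.
Qed.

Lemma runs_push j g sg : j < k.+1 ->
  runs (push j g) sg 2 (set_nth [::] sg j (g (view_of sg) :: nth [::] sg j)).
Proof.
move=> lt_j ts rep; eexists _, _; split; first exact: leqnn.
  apply: (@exec_step (push j g) None (Some (g (scan ts)))) => //.
  exact: (@exec_exit (push j g)).
have [sz_sg H] := rep; split.
  by rewrite size_set_nth sz_sg; apply/maxn_idPr.
move=> i; rewrite !tnth_mktuple /= !tnth_mktuple nth_set_nth /=.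
case: eqP => [eq_i|_] //; rewrite (scan_represents rep) top_view -eq_i.
by rewrite -(holds_stack_scanned (H i)); apply: holds_stack_push.
Qed.

Lemma runs_seqp a b sg t sg' t' sg'' :
  runs a sg t sg' -> runs b sg' t' sg'' -> runs (seqp a b) sg (t + t') sg''.
Proof.
move=> run_a run_b ts /run_a[u [ts' [le_u ex_a /run_b]]].
case=> u' [ts'' [le_u' ex_b rep]]; exists (u + u'), ts''.
by split=> //; [apply: leq_add | apply: exec_seql ex_a ex_b].
Qed.

Lemma runs_leq a sg t t' sg' : t <= t' -> runs a sg t sg' -> runs a sg t' sg'.
Proof.
move=> le_t run_a ts /run_a[u [ts' [le_u ex_a rep]]].
by exists u, ts'; split=> //; apply: leq_trans le_t.
Qed.

Lemma runs_when_true (p : view -> bool) a sg t sg' :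
  p (view_of sg) -> runs a sg t sg' -> runs (when p a) sg t.+1 sg'.
Proof.
move=> p_sg run_a ts rep; have [u [ts' [le_u ex_a rep']]] :=
  run_a _ (represents_idle rep).
exists u.+1, ts'; split=> //.
apply: (@exec_step (when p a) _ (Some (entry a)) None).
  by rewrite /= (scan_represents rep) p_sg.
exact: exec_when.
Qed.

Lemma runs_when_false (p : view -> bool) a sg :
  ~~ p (view_of sg) -> runs (when p a) sg 1 sg.
Proof.
move=> /negbTE p_sg ts rep; exists 1, (apply_action None ts); split=> //.
  by apply: (@exec_exit (when p a)); rewrite /= (scan_represents rep) p_sg.
exact: represents_idle.
Qed.

Lemma runs_while_true (p : view -> bool) a sg t sg' t' sg'' :
  p (view_of sg) -> runs a sg t sg' -> runs (while p a) sg' t' sg'' ->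
  runs (while p a) sg (t + t').+1 sg''.
Proof.
move=> p_sg run_a run_w ts rep; have [u [ts' [le_u ex_a rep']]] :=
  run_a _ (represents_idle rep).
have [u' [ts'' [le_u' ex_w rep'']]] := run_w _ rep'.
exists (u + u').+1, ts''; split=> //; first by rewrite ltnS leq_add.
apply: (@exec_step (while p a) _ (Some (entry a)) None).
  by rewrite /= (scan_represents rep) p_sg.
exact: exec_while ex_a ex_w.
Qed.

Lemma runs_while_false (p : view -> bool) a sg :
  ~~ p (view_of sg) -> runs (while p a) sg 1 sg.
Proof.
move=> /negbTE p_sg ts rep; exists 1, (apply_action None ts); split=> //.
  by apply: (@exec_exit (while p a)); rewrite /= (scan_represents rep) p_sg.
exact: represents_idle.
Qed.

(* In [st l y], the loop still has to process [l] and has already processed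
   the elements of [y], the last one first. *)
Lemma runs_while_rev (X : Type) (p : view -> bool) a
    (st : seq X -> seq X -> stacks) t (P : pred X) l :
  (forall x l y, P x ->
     p (view_of (st (x :: l) y)) /\ runs a (st (x :: l) y) t (st l (x :: y))) ->
  (forall y, ~~ p (view_of (st [::] y))) -> all P l ->
  runs (while p a) (st l [::]) (t.+1 * size l).+1 (st [::] (rev l)).
Proof.
move=> body stop Pl; rewrite /rev.
have: forall y, runs (while p a) (st l y) (t.+1 * size l).+1
                  (st [::] (catrev l y)); last exact.
elim: l Pl => [|x l IH] /= Pl y.
  by rewrite muln0; apply: runs_while_false; apply: stop.
case/andP: Pl => Px Pl; have [p_sg run_a] := body x l y Px.
apply: runs_leq (runs_while_true p_sg run_a (IH Pl _)).
by rewrite mulnS; lia.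
Qed.

Definition transfer (test : option C -> bool) (c0 : C) i j : prog :=
  while (fun v => test (top i v))
    (seqp (push j (fun v => odflt c0 (top i v))) (pop i)).

Lemma runs_transfer (test : option C -> bool) c0 i j sg s1 s2 :
  i < k.+1 -> j < k.+1 -> i != j -> size sg = k.+1 ->
  nth [::] sg i = s1 ++ s2 -> all (fun x => test (Some x)) s1 ->
  ~~ test (ohead s2) ->
  runs (transfer test c0 i j) sg (4 * size s1).+1
    (set_nth [::] (set_nth [::] sg i s2) j (catrev s1 (nth [::] sg j))).
Proof.
move=> lt_i lt_j neq_ij; elim: s1 sg => [|x s1 IH] sg sz_sg sg_i /=.
  move=> _ test2; rewrite [X in runs _ _ _ X](_ : _ = sg); last first.
    apply: (@eq_from_nth _ [::]) => [|m _]; first by rewrite !size_set_nth; lia.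
    by do 2 rewrite nth_set_nth /=; do 2 case: eqP => [->|_] //.
  by apply: runs_while_false; rewrite top_view sg_i.
case/andP=> test_x test1 test2.
pose sg1 := set_nth [::] sg j (x :: nth [::] sg j).
pose sg2 := set_nth [::] sg1 i (s1 ++ s2).
have sg1_i : nth [::] sg1 i = x :: s1 ++ s2.
  by rewrite nth_set_nth /= (negbTE neq_ij) sg_i.
have body : runs (seqp (push j (fun v => odflt c0 (top i v))) (pop i)) sg 3 sg2.
  rewrite -[3]/(2 + 1); apply: (@runs_seqp _ _ _ _ sg1).
    have := @runs_push j (fun v => odflt c0 (top i v)) sg lt_j.
    by rewrite top_view sg_i.
  by have := @runs_pop i sg1 lt_i; rewrite sg1_i.
have sz_sg2 : size sg2 = k.+1 by rewrite !size_set_nth; lia.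
have sg2_i : nth [::] sg2 i = s1 ++ s2 by rewrite nth_set_nth /= eqxx.
have sg2_j : nth [::] sg2 j = x :: nth [::] sg j.
  by do 2 rewrite nth_set_nth /=; rewrite eq_sym (negbTE neq_ij) eqxx.
have := IH sg2 sz_sg2 sg2_i test1 test2; rewrite sg2_j.
rewrite [X in runs _ _ _ X -> _](_ : _ = set_nth [::] (set_nth [::] sg i s2) j
  (catrev s1 (x :: nth [::] sg j))); last first.
  apply: (@eq_from_nth _ [::]) => [|m _].
    by rewrite !size_set_nth; lia.
  by rewrite /sg2 /sg1; do 6 rewrite ?nth_set_nth /=;
    case: (m == j); case: (m == i).
move=> run_s1; apply: runs_leq (runs_while_true _ body run_s1).
  by rewrite mulnS.
by rewrite top_view sg_i.
Qed.

End StackPrograms.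

(** * Deciding machines from stack programs *)

Section Decision.
Variables (Sigma Gamma : finType) (k : nat).
Local Notation C := (Sigma + Gamma)%type.
Variables (a : prog C) (answer : seq (option C) -> bool).

Definition moves o (v : k.+1.-tuple (option C)) :
    k.+1.-tuple (option C * move) :=
  [tuple if o is Some (j, x) then
           if i == j :> nat then x else (tnth v i, Stay)
         else (tnth v i, Stay) | i < k.+1].

(** When the program exits, the state [inr None] spends one more step on computing the answer from
    the scanned cells. *)
Definition machine_delta (q : point a + option bool)
    (v : k.+1.-tuple (option C)) :
    (point a + option bool) * k.+1.-tuple (option C * move) :=
  match q with
  | inl q => let: (r, o) := act q v in
             (if r is Some q' then inl q' else inr None, moves o v)
  | inr None => (inr (Some (answer v)), moves None v)
  | inr (Some b) => (inr (Some b), moves None v)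
  end.

Definition machine_of : machine Sigma :=
  @Machine Sigma (point a + option bool)%type Gamma k (inl (entry a))
    (fun q => if q is inr (Some b) then Some b else None) machine_delta.

Lemma write_moves o (ts : k.+1.-tuple (tape C)) :
  [tuple write_move (tnth ts i) (tnth (moves o (map_tuple (@scanned _) ts)) i)
     | i < k.+1] = apply_action o ts.
Proof.
apply: eq_from_tnth => i; rewrite !tnth_mktuple !tnth_map /tape_action.
have idle (t : tape C) : write_move t (scanned t, Stay) = t by case: t.
by case: o => [[j x]|] //; case: ifP.
Qed.

Lemma exec_machine q ts t ts' : @exec C k a q ts t ts' ->
  iter t (@step Sigma machine_of) (Config (inl q : state machine_of) ts) =
  Config (inr None : state machine_of) ts'.
Proof.
elim=> {q ts t ts'} [q o ts E|q q' o ts t ts' E _ IH].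
  by rewrite /= /step /= E write_moves.
by rewrite iterSr -IH; congr iter; rewrite /step /= E write_moves.
Qed.

Lemma runs_answers (w : seq Sigma) t sg :
  runs k a (map inl w :: nseq k [::]) t sg ->
  answers_within machine_of w t.+1 (answer (view_of sg)).
Proof.
rewrite /answers_within /init => run_a.
set ts0 := (X in Config _ X).
have rep0 : represents (ts0 : k.+1.-tuple (tape C)) (map inl w :: nseq k [::]).
  split=> [|i]; first by rewrite /= size_nseq.
  rewrite tnth_mktuple -val_eqE /=.
  have -> j : nth [::] (map inl w :: nseq k [::]) j =
              if j == 0 then map inl w else [::] :> seq C.
    by case: j => //= j; rewrite nth_nseq if_same.
  case: ifP => _; last by case=> // j; rewrite /= !nth_nil.
  by case: w {run_a ts0} => [|x w] // [|j] //=; rewrite ?nth_nil.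
have [u [ts' [le_u ex_a rep]]] := run_a _ rep0.
(* Of the [t + 1] steps, [u] run the program and one answers; the other [t - u] fix the halted
   configuration. *)
rewrite -(subnK (leqW le_u : u <= t.+1)) iterD.
rewrite (exec_machine ex_a) subSn // iterSr /step /=.
rewrite -/(scan ts') (scan_represents rep).
set cf := Config _ _; have -> : iter (t - u) (@step Sigma machine_of) cf = cf.
  by elim: (t - u) => //= j ->.
by [].
Qed.

End Decision.

(** * The elimination algorithm as a stack program *)

Section EliminationProgram.
Variable n : nat.
Local Notation bin_rel := {set 'I_n * 'I_n}.
Local Notation C := (symbol + bin_rel)%type.
Local Notation runs := (@runs C 12).
Implicit Types (R : nat -> nat -> bin_rel) (v : seq (option C)).

Definition sep : C := inl SymComma.
Definition stroke : C := inl SymStroke.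
Definition quant_mark (q : nat) : C :=
  if q == 2 then inl SymStroke else inl SymQuant.

(* Unlike the boolean equality of [symbol], this reduces on constructors. *)
Definition is_symbol (s : symbol) (c : option C) : bool :=
  match s, c with
  | SymQuant, Some (inl SymQuant) | SymEdge, Some (inl SymEdge)
  | SymComma, Some (inl SymComma) | SymStroke, Some (inl SymStroke) => true
  | _, _ => false
  end.
Definition is_entry (c : option C) : bool :=
  if c is Some (inr _) then true else false.
Definition entry_of (c : option C) : bin_rel :=
  if c is Some (inr r) then r else setT.
(** Besides inverting [quant_mark], this decodes the input: once the quantifier symbol and one
    stroke are popped, a further stroke means threshold 2. *)
Definition quant_of (c : option C) : nat :=
  if is_symbol SymStroke c then 2 else 1.

(* IN is the unread input and QS the quantifiers, the innermost on top.  The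
   table is split between TB, read from its last entry on, and UP, read from
   its first entry on.  While y is eliminated, PV and PW share the entries
   (y, b), DG holds the entry (y, y), and HD the entry (a, y) of the current
   row a.  FL is nonempty as soon as some check has failed.  C1 to C4 are unary
   counters, namely two copies of the indices of the current atom. *)
Local Notation IN := 0 (only parsing).
Local Notation QS := 1 (only parsing).
Local Notation TB := 2 (only parsing).
Local Notation UP := 3 (only parsing).
Local Notation PV := 4 (only parsing).
Local Notation PW := 5 (only parsing).
Local Notation DG := 6 (only parsing).
Local Notation HD := 7 (only parsing).
Local Notation FL := 8 (only parsing).
Local Notation C1 := 9 (only parsing).
Local Notation C2 := 10 (only parsing).
Local Notation C3 := 11 (only parsing).
Local Notation C4 := 12 (only parsing).
Local Notation "a ;; b" := (seqp a b) (at level 60, right associativity).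
Local Notation nonempty j := (fun v => isSome (top j v)).

Definition copy_top i j : prog C :=
  push j (fun v => odflt sep (top i v)).
Definition shift_top i j : prog C := copy_top i j ;; pop C i.
Definition shift_all i j : prog C := transfer (@isSome C) sep i j.
Definition shift_entries i j : prog C := transfer is_entry sep i j.
Definition push_stroke j : prog C := push j (fun=> stroke).

(** The number of variables is left in unary on PV and C1, the inner and outer loop counters of
    [fill_table]. *)
Definition read_quants : prog C :=
  while (fun v => is_symbol SymQuant (top IN v))
    (pop C IN ;; pop C IN ;; push_stroke PV ;; push_stroke C1 ;;
     push QS (fun v => quant_mark (quant_of (top IN v))) ;;
     when (fun v => is_symbol SymStroke (top IN v)) (pop C IN)).

Definition fill_table : prog C :=
  while (nonempty C1)
    (while (nonempty PV) (push UP (fun=> inr setT) ;; shift_top PV PW) ;;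
     push UP (fun=> sep) ;; shift_all PW PV ;; pop C C1) ;;
  while (nonempty PV) (pop C PV).

(** With [a] strokes on C1 and [b] on C2, the first [a] rows, a separator and [b] entries move to
    TB. This exposes the entry (a, b) on UP; afterwards everything moves back. *)
Definition restrict_at : prog C :=
  while (nonempty C1) (shift_top UP TB ;; shift_entries UP TB ;; pop C C1) ;;
  shift_top UP TB ;;
  while (nonempty C2) (shift_top UP TB ;; pop C C2) ;;
  put UP (fun v => inr (edge_rel n :&: entry_of (top UP v))) ;;
  shift_all TB UP.

Definition read_index i j : prog C :=
  while (fun v => is_symbol SymStroke (top IN v))
    (push_stroke i ;; push_stroke j ;; pop C IN).

(** The first [restrict_at] uses up C1 and C2; the copies on C3 and C4 then supply the indices in
    swapped order for the other orientation. *)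
Definition read_atoms : prog C :=
  while (fun v => is_symbol SymEdge (top IN v))
    (pop C IN ;; read_index C1 C4 ;; pop C IN ;; read_index C2 C3 ;;
     restrict_at ;; shift_all C3 C1 ;; shift_all C4 C2 ;; restrict_at).

Definition eliminate_top v : C :=
  inr (eliminate_entry (quant_of (top QS v)) (entry_of (top DG v))
         (entry_of (top HD v)) (entry_of (top PV v)) (entry_of (top TB v))).

Definition check_fails v : bool :=
  ~~ (quant_of (top QS v) <= #|diag (entry_of (top DG v))|).

(** A row on TB starts with its last entry, so (a, y) is on top and goes to HD. Then (a, b) on TB
    and (y, b) on PV appear in step, and PW saves the latter for the next row. *)
Definition eliminate_row : prog C :=
  shift_top TB HD ;;
  while (nonempty PV) (push UP eliminate_top ;; pop C TB ;; shift_top PV PW) ;;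
  shift_top TB UP ;; shift_all PW PV ;; pop C HD.

(** The row of y lies on top of TB and leaves the table: (y, y) goes to DG, the rest to PV, by way
    of PW so that its order is kept. A failed test is only recorded, and the run continues. *)
Definition eliminate_var : prog C :=
  shift_top TB DG ;; when check_fails (push_stroke FL) ;;
  shift_entries TB PW ;; pop C TB ;; shift_all PW PV ;;
  while (nonempty TB) eliminate_row ;;
  while (nonempty PV) (pop C PV) ;; shift_all UP TB ;; pop C DG ;; pop C QS.

Definition solver : prog C :=
  read_quants ;; fill_table ;; read_atoms ;; shift_all UP TB ;;
  while (nonempty QS) eliminate_var.

Definition accepting v : bool := ~~ isSome (top FL v).

(** * Layout of the table on the stacks *)

Definition row R m a : seq C := sep :: [seq inr (R a b) | b <- iota 0 m].
Definition rows R m (s : seq nat) : seq C := flatten [seq row R m a | a <- s].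
Definition rev_row R m a : seq C :=
  rcons [seq inr (R a b) | b <- rev (iota 0 m)] sep.
Definition rev_rows R m (s : seq nat) : seq C :=
  flatten [seq rev_row R m a | a <- s].

Lemma rev_rowE R m a : rev (row R m a) = rev_row R m a.
Proof. by rewrite /row /rev_row rev_cons map_rev. Qed.

Lemma rev_rowsE R m s : rev (rows R m s) = rev_rows R m (rev s).
Proof.
rewrite /rows /rev_rows rev_flatten -map_comp map_rev.
by congr (flatten (rev _)); apply: eq_map => a; apply: rev_rowE.
Qed.

Ltac norm := cbn [set_nth nth behead view_of map ohead top odflt oapp].

Lemma runs_shift_top i j x s sg : i < 13 -> j < 13 -> i != j ->
  nth [::] sg i = x :: s ->
  runs (shift_top i j) sg 3
    (set_nth [::] (set_nth [::] sg j (x :: nth [::] sg j)) i s).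
Proof.
move=> lt_i lt_j neq_ij sg_i; rewrite -[3]/(2 + 1).
apply: (@runs_seqp _ _ _ _ _ _ (set_nth [::] sg j (x :: nth [::] sg j))).
  have := @runs_push _ 12 j (fun v => odflt sep (top i v)) sg lt_j.
  by rewrite top_view sg_i.
have := @runs_pop C 12 i (set_nth [::] sg j (x :: nth [::] sg j)) lt_i.
by rewrite nth_set_nth /= (negbTE neq_ij) sg_i.
Qed.

Lemma runs_shift_all i j sg s t : i < 13 -> j < 13 -> i != j ->
  size sg = 13 -> nth [::] sg i = s -> 4 * size s < t ->
  runs (shift_all i j) sg t
    (set_nth [::] (set_nth [::] sg i [::]) j (catrev s (nth [::] sg j))).
Proof.
move=> lt_i lt_j neq_ij sz_sg sg_i lt_t; apply: runs_leq lt_t _.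
apply: runs_transfer => //; first by rewrite cats0.
exact: all_predT.
Qed.

Lemma runs_shift_entries i j sg s1 s2 t :
  i < 13 -> j < 13 -> i != j -> size sg = 13 ->
  nth [::] sg i = s1 ++ s2 -> all (fun x => is_entry (Some x)) s1 ->
  ~~ is_entry (ohead s2) -> 4 * size s1 < t ->
  runs (shift_entries i j) sg t
    (set_nth [::] (set_nth [::] sg i s2) j (catrev s1 (nth [::] sg j))).
Proof.
move=> lt_i lt_j neq_ij sz_sg sg_i all1 s2_stop lt_t.
by apply: runs_leq lt_t _; apply: runs_transfer.
Qed.

(** * Effect and running time of the subprograms *)

Lemma runs_read_quants qs rest t u w d h f c2 c3 c4 :
  all (pred2 1 2) qs ->
  ~~ is_symbol SymQuant (ohead (map inl rest)) ->
  ~~ is_symbol SymStroke (ohead (map inl rest)) ->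
  runs read_quants
    [:: map inl (flatten (map encode_quant qs) ++ rest); [::]; t; u; [::]; w;
        d; h; f; [::]; c2; c3; c4]
    (11 * size qs).+1
    [:: map inl rest; map quant_mark (rev qs); t; u;
        nseq (size qs) stroke; w; d; h; f; nseq (size qs) stroke; c2; c3; c4].
Proof.
move=> qs12 restQ restS.
pose st l y : seq (seq C) :=
  [:: map inl (flatten (map encode_quant l) ++ rest); map quant_mark y; t; u;
      nseq (size y) stroke; w; d; h; f; nseq (size y) stroke; c2; c3; c4].
(* No stroke follows a completely read quantifier, so threshold 1 is not mistaken for 2. *)
have headS l : ~~ is_symbol SymStroke
    (ohead [seq inl i | i <- flatten (map encode_quant l) ++ rest] : option C).
  by case: l.
rewrite -(size_rev qs) -/(st [::] (rev qs)) size_rev -/(st qs [::]).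
apply: (@runs_while_rev _ _ _ _ _ _ 10 (pred2 1 2)) => // q l y q12.
split; first by [].
(* One summand per command: a pop takes 1 step, a push 2, and the conditional pop at most 2. The
   loop test adds 1 per round. *)
apply: (@runs_leq _ _ _ _ (1 + (1 + (2 + (2 + (2 + 2)))))) => //.
rewrite /st.
apply: runs_seqp; first exact: runs_pop.
norm.
apply: runs_seqp; first exact: runs_pop.
norm.
apply: runs_seqp; first exact: runs_push.
norm.
apply: runs_seqp; first exact: runs_push.
norm.
apply: runs_seqp; first exact: runs_push.
norm.
case/pred2P: q12 => -> /=.
  apply: (@runs_leq _ _ _ _ 1) => //.
  rewrite /quant_of (negbTE (headS l)).
  by apply: runs_when_false; apply: headS.
by apply: runs_when_true => //; apply: runs_pop.
Qed.

Lemma runs_drain j sg s t : j < 13 -> size sg = 13 -> nth [::] sg j = s ->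
  2 * size s < t ->
  runs (while (nonempty j) (pop C j)) sg t (set_nth [::] sg j [::]).
Proof.
move=> lt_j sz_sg sg_j lt_t; apply: runs_leq lt_t _.
elim: s sg sz_sg sg_j => [|x s IH] sg sz_sg sg_j.
  rewrite [X in runs _ _ _ X](_ : _ = sg); last first.
    apply: (@eq_from_nth _ [::]) => [|i _]; first by rewrite size_set_nth; lia.
    by rewrite nth_set_nth /=; case: eqP => // ->.
  by apply: runs_while_false; rewrite top_view sg_j.
have := @runs_pop C 12 j sg lt_j; rewrite sg_j /= => run_pop.
have sz1 : size (set_nth [::] sg j s) = 13 by rewrite size_set_nth; lia.
have nth1 : nth [::] (set_nth [::] sg j s) j = s by rewrite nth_set_nth /= eqxx.
have := IH _ sz1 nth1; rewrite set_set_nth eqxx => run_s.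
apply: runs_leq (runs_while_true _ run_pop run_s); first by rewrite /=; lia.
by rewrite top_view sg_j.
Qed.

Lemma runs_fill_table m i q d h f c2 c3 c4 :
  runs fill_table
    [:: i; q; [::]; [::]; nseq m stroke; [::]; d; h; f; nseq m stroke;
        c2; c3; c4]
    (20 * (m.+1 * m.+1))
    [:: i; q; [::]; rows (fun _ _ => setT) m (iota 0 m); [::]; [::]; d; h; f;
        [::]; c2; c3; c4].
Proof.
(* All entries are full, so all rows equal row 0. *)
pose r := row (fun _ _ => setT) m 0.
have fill_row u l : runs
    (while (nonempty PV) (push UP (fun=> inr setT) ;; shift_top PV PW))
    [:: i; q; [::]; u; nseq m stroke; [::]; d; h; f; l; c2; c3; c4]
    (6 * m).+1
    [:: i; q; [::]; nseq m (inr setT) ++ u; [::]; nseq m stroke; d; h; f; l;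
        c2; c3; c4].
  pose st (l1 y : seq C) : seq (seq C) :=
    [:: i; q; [::]; nseq (size y) (inr setT) ++ u; l1; y; d; h; f; l;
        c2; c3; c4].
  have := @runs_while_rev C 12 _ (nonempty PV)
    (push UP (fun=> inr setT) ;; shift_top PV PW) st 5 predT (nseq m stroke).
  rewrite /st size_rev size_nseq rev_nseq; apply=> // [x l1 y _|].
    split=> //; apply: (@runs_leq _ _ _ _ (2 + 3)) => //.
    apply: runs_seqp; first exact: runs_push.
    norm; exact: runs_shift_top.
  exact: all_predT.
pose st (l y : seq C) : seq (seq C) :=
  [:: i; q; [::]; flatten (nseq (size y) r); nseq m stroke; [::]; d; h; f; l;
      c2; c3; c4].
have -> : rows (fun _ _ => setT) m (iota 0 m) = flatten (nseq m r).
  rewrite /rows (_ : [seq _ | a <- _] = [seq r | _ <- iota 0 m]) //.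
  by congr flatten; elim: (m) (0) => //= m' IH j; rewrite IH.
apply: (@runs_leq _ _ _ _ ((((6 * m).+1 + (2 + ((4 * m).+1 + 1))).+1 * m).+1
  + (2 * m).+1)).
  by nia.
apply: (@runs_seqp _ _ _ _ _ _ (st [::] (nseq m stroke))).
  have := @runs_while_rev C 12 _ (nonempty C1)
    (while (nonempty PV) (push UP (fun=> inr setT) ;; shift_top PV PW) ;;
     push UP (fun=> sep) ;; shift_all PW PV ;; pop C C1) st
    ((6 * m).+1 + (2 + ((4 * m).+1 + 1))) predT (nseq m stroke).
  rewrite size_nseq rev_nseq; apply=> // [x l y _|]; last exact: all_predT.
  split=> //.
  apply: runs_seqp; first exact: fill_row.
  norm; apply: runs_seqp; first exact: runs_push.
  norm; apply: runs_seqp.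
    by apply: runs_shift_all => //=; rewrite size_nseq.
  norm.
  have -> : nseq m (inr setT) = [seq inr setT | _ <- iota 0 m] :> seq C.
    by elim: (m) (0) => //= m' IH j; rewrite -IH.
  rewrite catrevE cats0 rev_nseq.
  exact: runs_pop.
by rewrite /st size_nseq; apply: runs_drain => //; rewrite size_nseq.
Qed.

Lemma size_rows R m s : size (rows R m s) = size s * m.+1.
Proof.
elim: s => //= a s IH; rewrite /rows /= size_cat size_map size_iota.
by rewrite -/(rows _ _ _) IH mulSn.
Qed.

Lemma size_rev_rows R m s : size (rev_rows R m s) = size s * m.+1.
Proof. by rewrite -(revK s) -rev_rowsE !size_rev size_rows size_rev. Qed.

Lemma rows_cat R m s1 s2 : rows R m (s1 ++ s2) = rows R m s1 ++ rows R m s2.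
Proof. by rewrite /rows map_cat flatten_cat. Qed.

Lemma rows_cons R m a s : rows R m (a :: s) = row R m a ++ rows R m s.
Proof. by []. Qed.

Lemma rev_rows_cons R m a s :
  rev_rows R m (a :: s) = rev_row R m a ++ rev_rows R m s.
Proof. by []. Qed.

Lemma iota_split a m :
  a < m -> iota 0 m = iota 0 a ++ a :: iota a.+1 (m - a.+1).
Proof. by move=> lt_a; rewrite -{1}(subnKC lt_a) addSnnS iotaD. Qed.

Lemma all_entries (s : seq nat) (F : nat -> bin_rel) :
  all (fun x : C => is_entry (Some x)) [seq inr (F b) | b <- s].
Proof. by rewrite all_map; apply/allP. Qed.

Lemma rows_restrict R m a b s :
  a \notin s -> rows (restrict_entry R a b) m s = rows R m s.
Proof.
move=> a_s; congr flatten; apply/eq_in_map => x x_s; congr (_ :: _).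
apply: eq_map => c; rewrite /restrict_entry; case: eqP => // eq_x.
by rewrite -eq_x x_s in a_s.
Qed.

Lemma row_restrict R m a b : b < m ->
  row (restrict_entry R a b) m a =
  sep :: [seq inr (R a c) | c <- iota 0 b] ++ inr (edge_rel n :&: R a b) ::
    [seq inr (R a c) | c <- iota b.+1 (m - b.+1)].
Proof.
move=> lt_b; rewrite /row (iota_split lt_b) map_cat /= {2}/restrict_entry !eqxx.
congr (_ :: _ ++ _ :: _); apply/eq_in_map => c;
  by rewrite mem_iota /restrict_entry eqxx /=; case: eqP => // ->; lia.
Qed.

Lemma runs_restrict_at R m a b i q p w d h f c3 c4 : a < m -> b < m ->
  runs restrict_at
    [:: i; q; [::]; rows R m (iota 0 m); p; w; d; h; f; nseq a stroke;
        nseq b stroke; c3; c4]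
    (30 * (m.+1 * m.+1))
    [:: i; q; [::]; rows (restrict_entry R a b) m (iota 0 m); p; w; d; h; f;
        [::]; [::]; c3; c4].
Proof.
move=> lt_a lt_b.
(* [rest1] is what remains on UP after the row loop, [rest2] what lies below the entry (a, b), and
   [seen] the content of TB when the column loop starts. *)
pose rest1 := row R m a ++ rows R m (iota a.+1 (m - a.+1)).
pose st1 l y : seq (seq C) :=
  [:: i; q; rev_rows R m y; rows R m l ++ rest1; p; w; d; h; f;
      nseq (size l) stroke; nseq b stroke; c3; c4].
pose rest2 := [seq inr (R a c) | c <- iota b.+1 (m - b.+1)] ++
  rows R m (iota a.+1 (m - a.+1)) : seq C.
pose seen := sep :: rev_rows R m (rev (iota 0 a)).
pose st2 l y : seq (seq C) :=
  [:: i; q; [seq inr (R a c) | c <- y] ++ seen;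
      [seq inr (R a c) | c <- l] ++ inr (R a b) :: rest2; p; w; d; h; f;
      [::]; nseq (size l) stroke; c3; c4].
have loop1 := @runs_while_rev C 12 _ (nonempty C1)
  (shift_top UP TB ;; shift_entries UP TB ;; pop C C1) st1
  (3 + ((4 * m).+1 + 1)) predT (iota 0 a).
have loop2 := @runs_while_rev C 12 _ (nonempty C2)
  (shift_top UP TB ;; pop C C2) st2 4 predT (iota 0 b).
rewrite /st1 /st2 !size_iota in loop1 loop2.
apply: (@runs_leq _ _ _ _ (((3 + ((4 * m).+1 + 1)).+1 * a).+1 +
  (3 + ((5 * b).+1 + (1 + (5 * (m * m.+1)).+1))))).
  by nia.
apply: (@runs_seqp _ _ _ _ _ _ (st1 [::] (rev (iota 0 a)))).
  have -> : rows R m (iota 0 m) = rows R m (iota 0 a) ++ rest1.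
    by rewrite (iota_split lt_a) rows_cat rows_cons.
  apply: loop1 => // [x l y _|].
    split=> //; rewrite rows_cons -catA /=.
    apply: runs_seqp; first exact: runs_shift_top.
    norm; apply: runs_seqp.
      apply: (@runs_shift_entries _ _ _ [seq inr (R x c) | c <- iota 0 m]
        (rows R m l ++ rest1)) => //.
      - exact: all_entries.
      - by case: l.
      by rewrite size_map size_iota.
    norm; rewrite catrevE /st1 rev_rows_cons /rev_row cat_rcons map_rev.
    exact: runs_pop.
  exact: all_predT.
rewrite {1}/st1 [_ ++ rest1](_ : _ = sep :: [seq inr (R a c) | c <- iota 0 b] ++
    inr (R a b) :: rest2); last first.
  by rewrite /rest1 /row (iota_split lt_b) map_cat /= -catA.
apply: runs_seqp; first exact: runs_shift_top.
norm; apply: (@runs_seqp _ _ _ _ _ _ (st2 [::] (rev (iota 0 b)))).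
  apply: loop2 => // [x l y _|].
    split=> //; apply: (@runs_leq _ _ _ _ (3 + 1)) => //.
    apply: runs_seqp; first exact: runs_shift_top.
    norm; exact: runs_pop.
  exact: all_predT.
apply: runs_seqp; first exact: runs_put.
norm; rewrite (iota_split lt_a) rows_cat rows_cons row_restrict //.
rewrite !rows_restrict ?mem_iota ?add0n ?ltnn ?andbF //.
(* [X] is the content of TB after both loops; reversing it onto UP completes the table around the
   new entry. *)
pose X := [seq inr (R a c) | c <- rev (iota 0 b)] ++ seen.
rewrite [rows R m _ ++ _](_ : _ =
    catrev X (inr (edge_rel n :&: R a b) :: rest2)).
  apply: runs_shift_all => //.
  rewrite /X size_cat size_map size_rev size_iota /seen /= size_rev_rows.
  by rewrite size_rev size_iota; nia.
rewrite catrevE /X rev_cat -map_rev revK /seen rev_cons -rev_rowsE revK.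
by rewrite -[RHS]catA cat_rcons /= -!catA.
Qed.

Definition encode_index (e : nat * nat) : seq symbol :=
  SymEdge :: nseq e.1 SymStroke ++ SymComma :: nseq e.2 SymStroke.

Lemma runs_read_index x y (w1 : seq symbol) q t u p w d h f c1 c2 c3 c4 j sg :
  (x, y) \in [:: (C1, C4); (C2, C3)] ->
  ~~ is_symbol SymStroke (ohead (map inl w1) : option C) ->
  sg = [:: map inl w1; q; t; u; p; w; d; h; f; c1; c2; c3; c4] ->
  runs (read_index x y)
    [:: map inl (nseq j SymStroke ++ w1); q; t; u; p; w; d; h; f;
        c1; c2; c3; c4]
    (6 * j).+1
    (set_nth [::] (set_nth [::] sg x (nseq j stroke ++ nth [::] sg x)) y
      (nseq j stroke ++ nth [::] sg y)).
Proof.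
move=> xy stop ->.
have cat_nseqS k s : nseq k stroke ++ stroke :: s = nseq k.+1 stroke ++ s.
  by elim: k => //= k ->.
elim: j c1 c2 c3 c4 => [|j IH] c1 c2 c3 c4.
  by case/or3P: xy => // /eqP[-> ->]; apply: runs_while_false.
apply: (@runs_leq _ _ _ _ ((2 + (2 + 1)) + (6 * j).+1).+1); first by lia.
case/or3P: xy IH => // /eqP[-> ->] /= IH.
  apply: runs_while_true => //.
    apply: runs_seqp; first exact: runs_push.
    norm; apply: runs_seqp; first exact: runs_push.
    norm; exact: runs_pop.
  by have := IH (stroke :: c1) c2 c3 (stroke :: c4); rewrite !cat_nseqS.
apply: runs_while_true => //.
  apply: runs_seqp; first exact: runs_push.
  norm; apply: runs_seqp; first exact: runs_push.
  norm; exact: runs_pop.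
by have := IH c1 (stroke :: c2) (stroke :: c3) c4; rewrite !cat_nseqS.
Qed.

Lemma runs_read_atoms m es q p w d h f :
  all (fun e => (e.1 < m) && (e.2 < m)) es ->
  runs read_atoms
    [:: map inl (flatten (map encode_index es)); q; [::];
        rows (fun _ _ => setT) m (iota 0 m); p; w; d; h; f;
        [::]; [::]; [::]; [::]]
    (100 * (m.+1 * m.+1) * size es).+1
    [:: [::]; q; [::]; rows (atom_table n es) m (iota 0 m); p; w; d; h; f;
        [::]; [::]; [::]; [::]].
Proof.
move=> es_m.
(* The loop lists processed atoms last first, while [atom_table] folds from the left; hence
   [rev y]. *)
pose st (l y : seq (nat * nat)) : seq (seq C) :=
  [:: map inl (flatten (map encode_index l)); q; [::];
      rows (atom_table n (rev y)) m (iota 0 m); p; w; d; h; f;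
      [::]; [::]; [::]; [::]].
rewrite -[X in atom_table n X]revK -/(st [::] (rev es)) -/(st es [::]).
apply: runs_leq; last first.
  apply: (@runs_while_rev _ _ _ _ _ _ (1 + ((6 * m).+1 + (1 + ((6 * m).+1 +
    (30 * (m.+1 * m.+1) + ((4 * m).+1 +
    ((4 * m).+1 + 30 * (m.+1 * m.+1)))))))) _ _ _ _ es_m) => //.
  move=> [i j] l y /andP[/= lt_i lt_j].
  split=> //; rewrite /st /= -catA /=.
  apply: runs_seqp; first exact: runs_pop.
  norm; apply: runs_seqp.
    apply: (@runs_leq _ _ _ _ (6 * i).+1); first by lia.
    exact: runs_read_index.
  norm; apply: runs_seqp; first exact: runs_pop.
  norm; apply: runs_seqp.
    apply: (@runs_leq _ _ _ _ (6 * j).+1); first by lia.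
    by apply: runs_read_index => //; case: l.
  norm; rewrite !cats0.
  apply: runs_seqp; first exact: runs_restrict_at.
  apply: runs_seqp.
    by apply: runs_shift_all => //; rewrite size_nseq; lia.
  norm; apply: runs_seqp.
    by apply: runs_shift_all => //; rewrite size_nseq; lia.
  norm; rewrite !catrevE !cats0 !rev_nseq rev_cons /atom_table foldl_rcons.
  exact: runs_restrict_at.
rewrite ltnS leq_mul //; nia.
Qed.

Lemma quant_markK q : pred2 1 2 q -> quant_of (Some (quant_mark q)) = q.
Proof. by case/pred2P=> ->. Qed.

Definition cols (F : nat -> bin_rel) (s : seq nat) : seq C :=
  [seq inr (F b) | b <- s].

Lemma rev_iotaS y : rev (iota 0 y.+1) = y :: rev (iota 0 y).
Proof. by rewrite -addn1 iotaD rev_cat. Qed.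

Lemma runs_eliminate_row R y a qs tb u q d h f c1 c2 c3 c4 i :
  pred2 1 2 q ->
  runs eliminate_row
    [:: i; quant_mark q :: qs; cols (R a) (rev (iota 0 y.+1)) ++ sep :: tb; u;
        cols (R y) (rev (iota 0 y)); [::]; inr (R y y) :: d; h; f;
        c1; c2; c3; c4]
    (20 * y.+1)
    [:: i; quant_mark q :: qs; tb; row (eliminate q y R) y a ++ u;
        cols (R y) (rev (iota 0 y)); [::]; inr (R y y) :: d; h; f;
        c1; c2; c3; c4].
Proof.
move=> q12; rewrite rev_iotaS /=.
pose st l z : seq (seq C) :=
  [:: i; quant_mark q :: qs; cols (R a) l ++ sep :: tb;
      cols (eliminate q y R a) z ++ u; cols (R y) l; cols (R y) z;
      inr (R y y) :: d; inr (R a y) :: h; f; c1; c2; c3; c4].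
apply: (@runs_leq _ _ _ _ (3 + ((7 * y).+1 + (3 + ((4 * y).+1 + 1))))).
  by lia.
apply: runs_seqp; first exact: runs_shift_top.
norm; apply: (@runs_seqp _ _ _ _ _ _ (st [::] (iota 0 y))).
  have := @runs_while_rev C 12 _ (nonempty PV)
    (push UP eliminate_top ;; pop C TB ;; shift_top PV PW) st 6 predT
    (rev (iota 0 y)).
  rewrite size_rev size_iota revK; apply=> // [b l z _|]; last exact: all_predT.
  split=> //; apply: (@runs_leq _ _ _ _ (2 + (1 + 3))) => //.
  rewrite /st /=; apply: runs_seqp; first exact: runs_push.
  norm; apply: runs_seqp; first exact: runs_pop.
  norm; rewrite /eliminate_top; norm; rewrite quant_markK //.
  exact: runs_shift_top.
rewrite /st /=; apply: runs_seqp; first exact: runs_shift_top.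
norm; apply: runs_seqp.
  by apply: runs_shift_all => //; rewrite size_map size_iota.
norm; rewrite catrevE cats0 /cols -map_rev.
exact: runs_pop.
Qed.

Lemma runs_eliminate_var R y qs q f i c1 c2 c3 c4 :
  pred2 1 2 q ->
  runs eliminate_var
    [:: i; quant_mark q :: qs; rev_rows R y.+1 (rev (iota 0 y.+1)); [::]; [::];
        [::]; [::]; [::]; f; c1; c2; c3; c4]
    (100 * (y.+1 * y.+1))
    [:: i; qs; rev_rows (eliminate q y R) y (rev (iota 0 y)); [::]; [::];
        [::]; [::]; [::]; if q <= #|diag (R y y)| then f else stroke :: f;
        c1; c2; c3; c4].
Proof.
move=> q12.
have rowE a : rev_row R y.+1 a = cols (R a) (rev (iota 0 y.+1)) ++ [:: sep].
  by rewrite cats1.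
rewrite {1}rev_iotaS rev_rows_cons rowE rev_iotaS /= -catA /=.
set f' := if _ then _ else _.
pose st l z : seq (seq C) :=
  [:: i; quant_mark q :: qs; rev_rows R y.+1 l;
      rows (eliminate q y R) y z; cols (R y) (rev (iota 0 y)); [::];
      [:: inr (R y y)]; [::]; f'; c1; c2; c3; c4].
apply: (@runs_leq _ _ _ _ (3 + (3 + ((4 * y).+1 + (1 + ((4 * y).+1 +
  (((20 * y.+1).+1 * y).+1 + ((2 * y).+1 +
  ((4 * (y * y.+1)).+1 + (1 + 1)))))))))).
  by nia.
apply: runs_seqp; first exact: runs_shift_top.
norm; apply: (@runs_seqp _ _ _ _ _ _
  [:: i; quant_mark q :: qs; cols (R y) (rev (iota 0 y)) ++ sep ::
      rev_rows R y.+1 (rev (iota 0 y)); [::]; [::]; [::]; [:: inr (R y y)];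
      [::]; f'; c1; c2; c3; c4]).
  rewrite /f'; case: ifP => [ok|bad].
    apply: (@runs_leq _ _ _ _ 1) => //; apply: runs_when_false.
    by rewrite /check_fails; norm; rewrite quant_markK ?ok.
  apply: runs_when_true; last exact: runs_push.
  by rewrite /check_fails; norm; rewrite quant_markK ?bad.
apply: runs_seqp.
  apply: (@runs_shift_entries _ _ _ (cols (R y) (rev (iota 0 y)))
    (sep :: rev_rows R y.+1 (rev (iota 0 y)))) => //; first exact: all_entries.
  by rewrite size_map size_rev size_iota.
norm; apply: runs_seqp; first exact: runs_pop.
norm; apply: runs_seqp.
  apply: runs_shift_all => //.
  by rewrite catrevE cats0 size_rev size_map size_rev size_iota.
norm; rewrite !catrevE !cats0 revK.
apply: (@runs_seqp _ _ _ _ _ _ (st [::] (iota 0 y))).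
  have := @runs_while_rev C 12 _ (nonempty TB) eliminate_row st (20 * y.+1)
    predT (rev (iota 0 y)).
  rewrite size_rev size_iota revK; apply=> // [a l z _|]; last exact: all_predT.
  rewrite /st rev_rows_cons rowE -catA /=; split; first by rewrite rev_iotaS.
  exact: runs_eliminate_row.
rewrite /st; apply: runs_seqp.
  by apply: runs_drain => //; rewrite size_map size_rev size_iota.
norm; apply: runs_seqp.
  by apply: runs_shift_all => //; rewrite size_rows size_iota.
norm; rewrite catrevE cats0 rev_rowsE; apply: runs_seqp; first exact: runs_pop.
norm; exact: runs_pop.
Qed.

(** The tables shrink during the run; the fixed bound [N] gives all rounds one common cost. *)
Lemma runs_eliminate_vars qs R f i c1 c2 c3 c4 N :
  all (pred2 1 2) qs -> size qs <= N ->
  exists f', nilp f' = nilp f && solve qs R /\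
  runs (while (nonempty QS) eliminate_var)
    [:: i; map quant_mark qs; rev_rows R (size qs) (rev (iota 0 (size qs)));
        [::]; [::]; [::]; [::]; [::]; f; c1; c2; c3; c4]
    ((100 * (N * N)).+1 * size qs).+1
    [:: i; [::]; [::]; [::]; [::]; [::]; [::]; [::]; f'; c1; c2; c3; c4].
Proof.
elim: qs R f => [|q qs IH] R f /=.
  by exists f; rewrite andbT muln0; split=> //; apply: runs_while_false.
case/andP=> q12 qs12 le_N.
pose f1 := if q <= #|diag (R (size qs) (size qs))| then f else stroke :: f.
have [f' [f'E run_qs]] := IH (eliminate q (size qs) R) f1 qs12 (ltnW le_N).
exists f'; split.
  by rewrite f'E /f1 andbA; case: ifP => _; rewrite ?andbT ?andbF.
have run_q := @runs_eliminate_var R (size qs) (map quant_mark qs) q f i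
  c1 c2 c3 c4 q12.
apply: runs_leq (runs_while_true _ run_q run_qs) => //.
rewrite [in X in _ < X]mulnS ltnS addnS -addSn leq_add2r.
by rewrite ltnS leq_mul2l leq_mul.
Qed.

Lemma size_flatten_map (X Y : Type) (F : X -> seq Y) s :
  (forall x, 0 < size (F x)) -> size s <= size (flatten (map F s)).
Proof.
by move=> F_gt0; elim: s => //= x s IH; rewrite size_cat -add1n leq_add.
Qed.

Lemma runs_solver qs es : all (pred2 1 2) qs ->
  all (fun e => (e.1 < size qs) && (e.2 < size qs)) es ->
  let w := flatten (map encode_quant qs) ++ flatten (map encode_index es) in
  exists sg, accepting (view_of sg) = solve (rev qs) (atom_table n es) /\
  runs solver (map inl w :: nseq 12 [::]) (300 * (size w).+1 ^ 3) sg.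
Proof.
move=> qs12 es_m w; set m := size qs in es_m *.
have [||f' [f'E run_elim]] :=
  @runs_eliminate_vars (rev qs) (atom_table n es)
    [::] [::] [::] [::] [::] [::] m.
- by rewrite all_rev.
- by rewrite size_rev.
exists [:: [::]; [::]; [::]; [::]; [::]; [::]; [::]; [::]; f';
           [::]; [::]; [::]; [::]].
split; first by move: f'E => /= <-; case: (f').
(* Every quantifier and every atom contributes at least one letter. *)
have le_m : m + size es <= size w.
  by rewrite size_cat; apply: leq_add; apply: size_flatten_map.
(* The summands are the five phases of [solver]. With [W] the word length plus one, [m + 1] and the
   number of atoms are at most [W], and the constants in front of powers up to [W ^ 3] add up to
   less than 300. *)
have solve_time : (11 * m).+1 + (20 * (m.+1 * m.+1) +
  ((100 * (m.+1 * m.+1) * size es).+1 + ((4 * (m * m.+1)).+1 +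
  ((100 * (m * m)).+1 * m).+1))) <= 300 * (size w).+1 ^ 3.
  have [mW esW] : m.+1 <= (size w).+1 /\ size es <= (size w).+1 by lia.
  have sq := leq_mul mW mW; have cube1 := leq_mul sq esW.
  have cube2 := leq_mul sq mW; move: (size w).+1 mW esW sq cube1 cube2 => W.
  have -> : W ^ 3 = W * W * W by rewrite !expnS expn0 muln1 mulnA.
  by move=> mW esW sq cube1 cube2; have := leq_mul (leqnn (W * W)) mW; lia.
apply: runs_leq solve_time _.
apply: runs_seqp.
  by apply: runs_read_quants => //; case: (es).
apply: runs_seqp; first exact: runs_fill_table.
apply: runs_seqp; first exact: runs_read_atoms.
apply: runs_seqp.
  by apply: runs_shift_all => //; rewrite size_rows size_iota.
by norm; rewrite catrevE cats0 rev_rowsE; rewrite !size_rev in run_elim.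
Qed.

End EliminationProgram.

(** * Polynomial time for thresholds 1 and 2 on a path *)

Theorem theorem2 (n : nat) :
  CSP_polynomial_time (pred2 1 2) (@path_edge n).
Proof.
exists (@machine_of symbol {set 'I_n * 'I_n} 12 (solver n) (@accepting n)).
(* Here 2400 is [300 * 2 ^ 3], from [(s + 1) ^ 3 <= (2 * s) ^ 3] for word length [s > 0]; the
   additive constant covers the empty word and the answering step. *)
exists 2400.+1, 3 => phi.
have [|sg [sgE run_sg]] :=
  @runs_solver n (quants phi) (nat_atoms (atoms phi)) (quants_in phi).
  by apply/allP => _ /mapP[e _ ->]; rewrite size_tuple !ltn_ord.
rewrite holds_solve -sgE.
set w := flatten _ ++ _ in run_sg; have -> : encode phi = w.
  by rewrite /w /encode /nat_atoms -map_comp.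
rewrite addnS; apply: runs_answers.
apply: runs_leq run_sg; have [->//|w_gt0] := posnP (size w).
have : (size w).+1 ^ 3 <= (2 * size w) ^ 3 by rewrite leq_exp2r //; lia.
by rewrite expnMn; move: (size w ^ 3) (_.+1 ^ 3); lia.
Qed.
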